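(* Let $n\in\mathbb{N}$, $n\geq 1$, $\lambda>0$, $\nu\in\mathbb{R}^n\setminus\{0\}$, and write $\hat\nu=\nu/|\nu|$. Then $$\big\| e^{-\lambda^2 t+\lambda\hat\nu\cdot x}\, S_\nu\phi\big\|_{L^2((0,\infty)\times\mathbb{R}^n)} \leq \frac{1}{2\lambda|\nu|}\,\big\| e^{-\lambda^2 t+\lambda\hat\nu\cdot x}\,\phi\big\|_{L^2((0,\infty)\times\mathbb{R}^n)}$$ for all $\phi\in\mathcal{D}((0,\infty)\times\mathbb{R}^n)$.
   Context: $\mathcal{D}(\Omega)$ denotes the space of smooth compactly supported functions in the open set $\Omega$. The $n$-dimensional heat kernel is $H_n(t,x) = (4\pi t)^{-n/2}e^{-|x|^2/(4t)}$ for $t>0$, $x\in\mathbb{R}^n$. The operator $S_\nu$ is defined by $$S_\nu\phi(t,x) = \int_0^t\Big(\int_{\mathbb{R}^n} H_n(t-s,\,x-y+2(t-s)\nu)\,\phi(s,y)\,\mathrm{d}y\Big)\mathrm{d}s,\qquad (t,x)\in(0,\infty)\times\mathbb{R}^n .$$ *)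

(* Defs.v *)
From HB Require Import structures.
From mathcomp Require Import all_boot all_order all_algebra.
From mathcomp Require Import all_classical all_reals all_analysis.
From mathcomp Require Import complex.

Set Implicit Arguments.
Unset Strict Implicit.
Unset Printing Implicit Defensive.

Import Order.TTheory GRing.Theory Num.Theory.
Import numFieldNormedType.Exports.
Local Open Scope classical_set_scope.
Local Open Scope ring_scope.
Local Open Scope complex_scope.

(* R^n is 'rV[R]_n.  Its sigma-algebra is generated by the coordinates,
   exactly as the library does for n.-tuple. *)
Section measurable_rV.
Context {R : realType} (n : nat).

Definition rV_coord (i : 'I_n) (x : 'rV[R]_n) : R := x ord0 i.

Let rV_set0 : g_sigma_preimage rV_coord set0.
Proof. exact: sigma_algebra0. Qed.

Let rV_setC A : g_sigma_preimage rV_coord A -> g_sigma_preimage rV_coord (~` A).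
Proof. exact: sigma_algebraC. Qed.

Let rV_bigcup (F : _^nat) : (forall i, g_sigma_preimage rV_coord (F i)) ->
  g_sigma_preimage rV_coord (\bigcup_i (F i)).
Proof. exact: sigma_algebra_bigcup. Qed.

HB.instance Definition _ := @isMeasurable.Build default_measure_display
  'rV[R]_n (g_sigma_preimage rV_coord) rV_set0 rV_setC rV_bigcup.

End measurable_rV.

Lemma measurable_rV_coord (R : realType) n (i : 'I_n) :
  measurable_fun [set: 'rV[R]_n] (rV_coord i).
Proof.
move=> _ Y mY; rewrite setTI; apply: sub_sigma_algebra => /=.
rewrite -bigcup_seq/=; exists i => /=; first by rewrite mem_index_enum.
by exists Y => //; rewrite setTI.
Qed.

Lemma measurable_fun_rVP (R : realType) n d (T : measurableType d)
    (f : T -> 'rV[R]_n) :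
  (forall i, measurable_fun [set: T] (fun x => rV_coord i (f x))) ->
  measurable_fun [set: T] f.
Proof.
move=> mf.
have sub : g_sigma_preimage (fun i => rV_coord i \o f) `<=` measurable.
  apply: smallest_sub; first exact: sigma_algebra_measurable.
  case: n f mf => [|m] f mf; first by rewrite big_ord0.
  rewrite -bigcup_mkord_ord; apply: bigcup_sub => i Ii.
  by move=> A [B mB <-]; exact: mf.
move=> _ A mA; apply: sub; rewrite g_sigma_preimage_comp.
by exists A.
Qed.

Section lebesgue_rV.
Context {R : realType}.

Definition rV_cons n (p : R * 'rV[R]_n) : 'rV[R]_n.+1 :=
  row_mx (p.1%:M : 'rV_1) p.2.

Lemma measurable_rV_cons n : measurable_fun [set: R * 'rV[R]_n] (@rV_cons n).
Proof.
apply: measurable_fun_rVP => i; rewrite /rV_coord /rV_cons.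
under eq_fun do rewrite mxE.
case: splitP => j _.
  under eq_fun do rewrite !ord1 mxE eqxx mulr1n.
  exact: measurable_fst.
exact: measurableT_comp (measurable_rV_coord j) measurable_snd.
Qed.

Lemma measurable_rV_uncons n :
  measurable_fun [set: 'rV[R]_n.+1] (fun x : 'rV[R]_n.+1 =>
    (x ord0 ord0, rsubmx (x : 'rV_(1 + n)))).
Proof.
apply/measurable_fun_pairP; split.
  exact: (measurable_rV_coord ord0).
apply: measurable_fun_rVP => i; rewrite /rV_coord.
under eq_fun do rewrite /= mxE.
exact: (measurable_rV_coord (rshift 1 i)).
Qed.

Lemma rV_cons0 n (p : R * 'rV[R]_n) : rV_cons p ord0 ord0 = p.1.
Proof.
rewrite mxE; case: splitP => [j _|j /esym/eqP]; last by rewrite addn_eq0.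
by rewrite !ord1 mxE eqxx mulr1n.
Qed.

Lemma rV_consS n (p : R * 'rV[R]_n) i : rV_cons p ord0 (lift ord0 i) = p.2 ord0 i.
Proof.
rewrite (_ : lift ord0 i = rshift 1 i); last exact/val_inj.
exact: row_mxEr.
Qed.

Lemma rV_consK n : cancel (@rV_cons n)
  (fun x : 'rV[R]_n.+1 => (x ord0 ord0, rsubmx (x : 'rV_(1 + n)))).
Proof. by case=> a x; rewrite rV_cons0 /rV_cons row_mxKr. Qed.

Section lebesgue_rV_succ.
Variables (n : nat) (m : {sigma_finite_measure set 'rV[R]_n -> \bar R}).
Local Open Scope ereal_scope.

Definition lebesgue_rV_succ : set 'rV[R]_n.+1 -> \bar R :=
  pushforward (lebesgue_measure \x m) (@rV_cons n).

Let succ0 : lebesgue_rV_succ set0 = 0.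
Proof. by rewrite /lebesgue_rV_succ /pushforward preimage_set0 measure0. Qed.

Let succ_ge0 A : 0 <= lebesgue_rV_succ A.
Proof. by rewrite /lebesgue_rV_succ /pushforward; exact: integral_ge0. Qed.

Let succ_sigma_additive : semi_sigma_additive lebesgue_rV_succ.
Proof.
move=> F mF tF mUF; rewrite /lebesgue_rV_succ /pushforward preimage_bigcup.
apply: measure_semi_sigma_additive.
- move=> k; rewrite -[X in measurable X]setTI.
  exact: measurable_rV_cons.
- apply/trivIsetP => /= i j _ _ ij; rewrite -preimage_setI.
  by move/trivIsetP : tF => /(_ _ _ _ _ ij) ->//; rewrite preimage_set0.
- rewrite -preimage_bigcup -[X in measurable X]setTI.
  exact: measurable_rV_cons.
Qed.

HB.instance Definition _ := isMeasure.Build _ _ _ lebesgue_rV_succ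
  succ0 succ_ge0 succ_sigma_additive.

Let succ_sigma_finite : sigma_finite setT lebesgue_rV_succ.
Proof.
have /sigma_finiteP[F [TF ndF Foo]] := sigma_finiteT (@lebesgue_measure R).
have /sigma_finiteP[G [TG ndG Goo]] := sigma_finiteT m.
pose uncons (x : 'rV[R]_n.+1) := (x ord0 ord0, rsubmx (x : 'rV_(1 + n))).
exists (fun k => uncons @^-1` (F k `*` G k)).
  rewrite -preimage_bigcup -[LHS](preimage_setT uncons); congr (_ @^-1` _).
  apply/esym; rewrite -subTset => -[a x] _.
  have [k _ Fka] : (\bigcup_k F k) a by rewrite -TF.
  have [l _ Glx] : (\bigcup_l G l) x by rewrite -TG.
  exists (maxn k l) => //; split => /=.
    by move: a Fka; exact/subsetPset/ndF/leq_maxl.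
  by move: x Glx; exact/subsetPset/ndG/leq_maxr.
move=> k; have [mFk Fkoo] := Foo k; have [mGk Gkoo] := Goo k.
split.
  rewrite -[X in measurable X]setTI.
  by apply: (@measurable_rV_uncons n measurableT); exact: measurableX.
rewrite /lebesgue_rV_succ /pushforward -comp_preimage.
rewrite (_ : _ \o _ = id); last by apply/funext => p; exact: rV_consK.
by rewrite preimage_id product_measure1E// lte_mul_pinfty// ge0_fin_numE.
Qed.

HB.instance Definition _ := @Measure_isSigmaFinite.Build _ _ _ lebesgue_rV_succ
  succ_sigma_finite.

End lebesgue_rV_succ.

Fixpoint lebesgue_rV n : {sigma_finite_measure set 'rV[R]_n -> \bar R} :=
  match n with
  | 0%N => dirac (0 : 'rV[R]_0)
  | n'.+1 => lebesgue_rV_succ (lebesgue_rV n')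
  end.

(* The product rule on boxes, which determines the measure. *)
Lemma lebesgue_rV_box n (A : 'I_n -> set (measurableTypeR R)) :
  (forall i, measurable (A i)) ->
  lebesgue_rV n [set x | forall i, A i (x ord0 i)] =
  (\prod_(i < n) lebesgue_measure (A i))%E.
Proof.
elim: n A => [|n IHn] A mA /=.
  by rewrite big_ord0 diracE mem_set// => -[].
pose B := [set x : 'rV[R]_n | forall i, A (lift ord0 i) (x ord0 i)].
have mB : measurable B.
  rewrite (_ : B =
      \bigcap_(i in [set: 'I_n]) (rV_coord i @^-1` A (lift ord0 i))).
    apply: fin_bigcap_measurable; first exact: finite_finset.
    move=> i _; rewrite -[X in measurable X]setTI.
    by apply: (@measurable_rV_coord R n i measurableT); exact: mA.
  by apply/seteqP; split => [x Bx i _|x Bx i]; exact: Bx.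
rewrite big_ord_recl -(IHn (fun i => A (lift ord0 i)))//.
rewrite -[RHS]product_measure1E// /lebesgue_rV_succ /pushforward.
congr (product_measure1 _ _ _); apply/seteqP; split => [p Ap|p [A0 AS] i] /=.
  split => [|i]; first by rewrite -(rV_cons0 p); exact: Ap.
  by rewrite -rV_consS; exact: Ap.
by case: (unliftP ord0 i) => [j|] ->; rewrite ?rV_consS ?rV_cons0//; exact: AS.
Qed.

End lebesgue_rV.

Section euclidean.
Context {R : realType} {n : nat}.

Definition dotv (x y : 'rV[R]_n) : R := \sum_(i < n) x ord0 i * y ord0 i.

(* The library norm `|x| on 'rV[R]_n is the max norm. *)
Definition enorm (x : 'rV[R]_n) : R := Num.sqrt (dotv x x).

End euclidean.

(* All iterated directional derivatives exist and are continuous; in finite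
   dimension this is C^oo. *)
Definition smooth {R : realType} {V : normedModType R} (f : V -> R) : Prop :=
  forall vs : seq V, let g := foldr (fun v h => 'D_v h) f vs in
    continuous g /\ forall v x, derivable g x v.

(* The space D(U): elements are identified with their extension by zero to
   the whole of V, so the support is a compact subset of V contained in U. *)
Definition test_function {R : realType} {V : normedModType R} (U : set V)
    (f : V -> R[i]) : Prop :=
  [/\ smooth (fun x => complex.Re (f x)), smooth (fun x => complex.Im (f x)),
      compact (closure [set x | f x != 0]) &
      closure [set x | f x != 0] `<=` U].

Definition Cintegral d (T : measurableType d) (R : realType)
    (mu : {measure set T -> \bar R}) (D : set T) (f : T -> R[i]) : R[i] :=
  (\int[mu]_(x in D) complex.Re (f x)) +i* (\int[mu]_(x in D) complex.Im (f x)).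

(* The L^2(D) norm, as the L^2 norm of the extension by zero outside D. *)
Definition L2norm d (T : measurableType d) (R : realType)
    (mu : {measure set T -> \bar R}) (D : set T) (f : T -> R[i]) : \bar R :=
  Lnorm mu 2%:E ((fun x => (Normc.normc (f x))%:E) \_ D).

Definition heat_kernel (R : realType) (n : nat) (t : R) (x : 'rV[R]_n) : R :=
  (4 * pi * t) `^ (- (n%:R / 2)) * expR (- (enorm x ^+ 2) / (4 * t)).

Definition half_space (R : realType) (n : nat) : set (R * 'rV[R]_n) :=
  [set z | 0 < z.1].

Definition lebesgue_spacetime (R : realType) (n : nat) :
    {measure set (measurableTypeR R * 'rV[R]_n)%type -> \bar R} :=
  (@lebesgue_measure R \x lebesgue_rV n)%E.

(* The operator S_nu. *)
Definition heat_drift (R : realType) (n : nat) (nu : 'rV[R]_n)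
    (phi : R * 'rV[R]_n -> R[i]) (z : R * 'rV[R]_n) : R[i] :=
  let: (t, x) := z in
  Cintegral lebesgue_measure `]0, t[ (fun s =>
    Cintegral (lebesgue_rV n) setT (fun y =>
      (heat_kernel (t - s) (x - y + (2 * (t - s)) *: nu))%:C * phi (s, y))).

Definition exp_weight (R : realType) (n : nat) (lambda : R) (nu : 'rV[R]_n)
    (z : R * 'rV[R]_n) : R :=
  expR (- (lambda ^+ 2) * z.1 + lambda * dotv ((enorm nu)^-1 *: nu) z.2).

Arguments half_space : clear implicits.
Arguments lebesgue_spacetime : clear implicits.

(* Main.v *)
Require Import Defs.
From HB Require Import structures.
From mathcomp Require Import all_boot all_order all_algebra.
From mathcomp Require Import all_classical all_reals all_analysis.
From mathcomp Require Import complex measurable_realfun ring.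

Set Implicit Arguments.
Unset Strict Implicit.
Unset Printing Implicit Defensive.

Import Order.TTheory GRing.Theory Num.Theory.
Import numFieldNormedType.Exports.
Local Open Scope classical_set_scope.
Local Open Scope ring_scope.
Local Open Scope complex_scope.

(* With w the exponential weight and a = 2 lambda |nu|, one has
   w S_nu phi = K * (w phi) where, after completing the square,
   K(t, x) = w(t, x) H(t, x + 2 t nu)
           = exp(- a t) H(t, x + 2 t nu - 2 t lambda nu / |nu|)  for t > 0.
   Since the heat kernel has mass 1 in x, K has L^1 norm at most 1 / a, and the
   bound is Young's inequality, obtained here as a Schur test. *)

(** * Monotonicity of integrals and norms of arbitrary functions *)

(** The integral of a nonnegative function is a supremum over the simple functions below it, so
    enlarging the function enlarges the set. Since [f] and [g] are arbitrary, [heat_drift] can later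
    be compared with a convolution without a proof that it is measurable. *)
Lemma ge0_le_integralT d (T : measurableType d) (R : realType)
    (mu : {measure set T -> \bar R}) (f g : T -> \bar R) :
  (forall x, 0 <= f x)%E -> (forall x, f x <= g x)%E ->
  (\int[mu]_x f x <= \int[mu]_x g x)%E.
Proof.
move=> f0 fg; rewrite !ge0_integralTE//; last first.
  by move=> x; exact: le_trans (f0 x) (fg x).
apply: ereal_sup_le => _ [h hf <-]; exists h => // x.
exact: le_trans (hf x) (fg x).
Qed.

Lemma ge0_le_poweR (R : realType) (p : R) (x y : \bar R) :
  0 <= p -> (0 <= x -> x <= y -> x `^ p <= y `^ p)%E.
Proof.
move=> p0 x0 xy; apply: gt0_ler_poweR => //.
  by rewrite in_itv/= x0 leey.
by rewrite in_itv/= (le_trans x0 xy) leey.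
Qed.

Lemma le_Lnorm d (T : measurableType d) (R : realType)
    (mu : {measure set T -> \bar R}) (p : R) (f g : T -> \bar R) :
  0 <= p -> (forall x, `|f x| <= `|g x|)%E ->
  (Lnorm mu p%:E f <= Lnorm mu p%:E g)%E.
Proof.
move=> p0 fg; rewrite unlock; apply: ge0_le_poweR; first by rewrite invr_ge0.
  by apply: integral_ge0 => x _; exact: poweR_ge0.
apply: ge0_le_integralT => x; first exact: poweR_ge0.
exact: ge0_le_poweR.
Qed.

(** * The Schur test on L^2 *)

Section schur.
Context d (T : measurableType d) (R : realType).
Variable mu : {sigma_finite_measure set T -> \bar R}.
Variables (k : T * T -> R) (c : R).
Hypotheses (mk : measurable_fun [set: T * T] k) (k0 : forall z, 0 <= k z).
Hypothesis row : forall x, (\int[mu]_y (k (x, y))%:E <= c%:E)%E.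
Hypothesis col : forall y, (\int[mu]_x (k (x, y))%:E <= c%:E)%E.

(** Cauchy-Schwarz in [y] for the splitting k g = sqrt(k) * (sqrt(k) g); the factor coming from
    sqrt(k) alone is a row integral, hence at most [c]. *)
Lemma schur_pointwise (g : T -> R) x :
  measurable_fun setT g -> (forall y, 0 <= g y) ->
  ((\int[mu]_y (k (x, y) * g y)%:E) `^ 2 <=
   c%:E * \int[mu]_y (k (x, y) * g y ^+ 2)%:E)%E.
Proof.
move=> mg g0.
have mkx : measurable_fun setT (fun y => k (x, y)) by exact: measurableT_comp.
pose r y := k (x, y) `^ 2^-1.
have mr : measurable_fun setT r by exact: measurableT_comp (measurable_powR _) mkx.
have r0 y : 0 <= r y by exact: powR_ge0.
have sqr y : r y ^+ 2 = k (x, y).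
  by rewrite -powR_mulrn// -powRrM mulVf ?powRr1.
have half : (2^-1 + 2^-1 = 1 :> R) by rewrite [RHS]splitr mul1r.
(* Both exponents are 2; [r] is the square root of the row of [k] at [x]. *)
have := hoelder mu mr (measurable_funM mr mg) (ltr0n R 2) (ltr0n R 2) half.
rewrite Lnorm1 => /(ge0_le_poweR (ler0n R 2)) => /(_ (integral_ge0 _ _)).
move/(_ (fun _ _ => abse_ge0 _)).
rewrite poweRM ?Lnorm_ge0// !poweR_Lnorm//.
rewrite [X in (X `^ _)%E](_ : _ = \int[mu]_y (k (x, y) * g y)%:E)%E; last first.
  apply: eq_integral => y _ /=.
  by rewrite ger0_norm ?mulr_ge0// mulrA -expr2 sqr.
rewrite (_ : \int[mu]_y `| (EFin \o r) y| `^ 2 = \int[mu]_y (k (x, y))%:E)%E; last first.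
  by apply: eq_integral => y _ /=; rewrite ger0_norm// powR_mulrn// sqr.
rewrite (_ : \int[mu]_y `| _ | `^ 2 = \int[mu]_y (k (x, y) * g y ^+ 2)%:E)%E; last first.
  apply: eq_integral => y _ /=.
  by rewrite ger0_norm ?mulr_ge0// powR_mulrn ?mulr_ge0// exprMn sqr.
move=> /le_trans; apply; apply: lee_wpmul2r => //.
by apply: integral_ge0 => y _; rewrite lee_fin mulr_ge0// sqr_ge0.
Qed.

(** Integrating the pointwise bound over [x] leaves one factor [c] from the rows; exchanging the
    integrals produces a second one from the columns, and the square root of c^2 is the constant. *)
Lemma schur_test (g : T -> R) :
  measurable_fun setT g -> (forall y, 0 <= g y) ->
  (Lnorm mu 2%:E (fun x => \int[mu]_y (k (x, y) * g y)%:E) <=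
   c%:E * Lnorm mu 2%:E (EFin \o g))%E.
Proof.
move=> mg g0.
have c0 : 0 <= c.
  rewrite -lee_fin (le_trans _ (row point))//.
  by apply: integral_ge0 => y _; rewrite lee_fin.
have mkg : measurable_fun setT (fun z : T * T => (k z * g z.2 ^+ 2)%:E).
  apply/measurable_EFinP; apply: measurable_funM => //.
  by apply: measurable_funX; exact: measurableT_comp.
have kg0 z : (0 <= (k z * g z.2 ^+ 2)%:E)%E by rewrite lee_fin mulr_ge0 ?sqr_ge0.
have key : (\int[mu]_x (\int[mu]_y (k (x, y) * g y)%:E) `^ 2 <=
    c%:E * (c%:E * \int[mu]_y (g y ^+ 2)%:E))%E.
  apply: (@le_trans _ _ (\int[mu]_x (c%:E * \int[mu]_y (k (x, y) * g y ^+ 2)%:E))%E).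
    by apply: ge0_le_integralT => x; [exact: poweR_ge0|exact: schur_pointwise].
  rewrite ge0_integralZl//; last 2 first.
  - exact: (measurable_fun_fubini_tonelli_F _ mkg kg0).
  - by move=> x _; apply: integral_ge0 => y _; exact: (kg0 (x, y)).
  apply: lee_wpmul2l; first by rewrite lee_fin.
  (* After the exchange, g(y)^2 leaves the inner integral in [x], and what remains there is a column
     integral. *)
  rewrite (fubini_tonelli _ mkg kg0)/=.
  apply: (@le_trans _ _ (\int[mu]_y (c%:E * (g y ^+ 2)%:E))%E).
    apply: ge0_le_integralT => y.
      by apply: integral_ge0 => x _; exact: (kg0 (x, y)).
    under eq_integral do rewrite EFinM.
    rewrite ge0_integralZr//; last 3 first.
    - by apply/measurable_EFinP; exact: measurableT_comp.
    - by move=> x _; rewrite lee_fin.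
    - by rewrite lee_fin sqr_ge0.
    by apply: lee_wpmul2r; [rewrite lee_fin sqr_ge0|exact: col].
  rewrite ge0_integralZl//.
    by apply/measurable_EFinP; exact: measurable_funX.
  by move=> y _; rewrite lee_fin sqr_ge0.
rewrite unlock.
have eqg : (\int[mu]_x (`|(EFin \o g) x| `^ 2) = \int[mu]_y (g y ^+ 2)%:E)%E.
  by apply: eq_integral => y _ /=; rewrite ger0_norm// powR_mulrn.
have eqk : (\int[mu]_x (`| \int[mu]_y (k (x, y) * g y)%:E | `^ 2) =
    \int[mu]_x (\int[mu]_y (k (x, y) * g y)%:E) `^ 2)%E.
  apply: eq_integral => x _; rewrite gee0_abs//.
  by apply: integral_ge0 => y _; rewrite lee_fin mulr_ge0.
rewrite eqg eqk.
have h0 : 0 <= 2^-1 :> R by rewrite invr_ge0.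
have i0 : (0 <= \int[mu]_x (\int[mu]_y (k (x, y) * g y)%:E) `^ 2)%E.
  by apply: integral_ge0 => x _; exact: poweR_ge0.
apply: le_trans (ge0_le_poweR h0 i0 key) _.
rewrite muleA -EFinM poweRM ?lee_fin ?mulr_ge0//; last first.
  by apply: integral_ge0 => y _; rewrite lee_fin sqr_ge0.
by rewrite poweR_EFin -expr2 -powR_mulrn// -powRrM mulfV// powRr1.
Qed.

End schur.

(** * Complex modulus and integrals of complex functions *)

Lemma normc_ge0 (R : rcfType) (z : R[i]) : 0 <= Normc.normc z.
Proof. by case: z => a b; exact: sqrtr_ge0. Qed.

Lemma normc_sqr (R : rcfType) (z : R[i]) :
  Normc.normc z ^+ 2 = complex.Re z ^+ 2 + complex.Im z ^+ 2.
Proof. by case: z => a b /=; rewrite sqr_sqrtr// addr_ge0 ?sqr_ge0. Qed.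

Lemma measurable_normc d (T : measurableType d) (R : realType) (D : set T)
    (f : T -> R[i]) :
  measurable_fun D (fun x => complex.Re (f x)) ->
  measurable_fun D (fun x => complex.Im (f x)) ->
  measurable_fun D (fun x => Normc.normc (f x)).
Proof.
move=> mr mi.
rewrite (_ : (fun x => _) = fun x =>
   (complex.Re (f x) ^+ 2 + complex.Im (f x) ^+ 2) `^ 2^-1); last first.
  apply/funext => x; rewrite -normc_sqr -powR_mulrn ?normc_ge0// -powRrM.
  by rewrite mulfV// powRr1 ?normc_ge0.
apply: measurableT_comp (measurable_powR _) _.
by apply: measurable_funD; exact: measurable_funX.
Qed.

Lemma norm_Re_le_normc (R : rcfType) (z : R[i]) : `|complex.Re z| <= Normc.normc z.
Proof.
by case: z => a b /=; rewrite -sqrtr_sqr ler_sqrt ?lerDl ?addr_ge0 ?sqr_ge0.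
Qed.

Lemma norm_Im_le_normc (R : rcfType) (z : R[i]) : `|complex.Im z| <= Normc.normc z.
Proof.
by case: z => a b /=; rewrite -sqrtr_sqr ler_sqrt ?lerDr ?addr_ge0 ?sqr_ge0.
Qed.

(** The left side is the real part of conj(z) w, whose modulus is |z| |w|. *)
Lemma dot_le_normcM (R : rcfType) (z w : R[i]) :
  complex.Re z * complex.Re w + complex.Im z * complex.Im w <=
  Normc.normc z * Normc.normc w.
Proof.
case: z w => [a b] [c d].
have := norm_Re_le_normc ((a +i* - b) * (c +i* d)).
rewrite Normc.normcM /= sqrrN mulNr opprK.
exact/le_trans/ler_norm.
Qed.

(** With z the integral of f, |z|^2 is the integral of Re(conj(z) f), which is at most |z| times the
    integral of |f|; then divide by |z|. *)
Lemma le_normc_Cintegral d (T : measurableType d) (R : realType)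
    (mu : {measure set T -> \bar R}) (D : set T) (f : T -> R[i]) :
  measurable D ->
  measurable_fun D (fun x => complex.Re (f x)) ->
  measurable_fun D (fun x => complex.Im (f x)) ->
  ((Normc.normc (Cintegral mu D f))%:E <=
   \int[mu]_(x in D) (Normc.normc (f x))%:E)%E.
Proof.
move=> mD mr mi.
(* If the right side is infinite there is nothing to prove; otherwise |f| is integrable, and so are
   the real and imaginary parts it dominates. *)
have [->|foo] := eqVneq (\int[mu]_(x in D) (Normc.normc (f x))%:E)%E +oo%E.
  by rewrite leey.
have mN : measurable_fun D (fun x => Normc.normc (f x)).
  exact: measurable_normc.
have iN : mu.-integrable D (EFin \o (fun x => Normc.normc (f x))).
  apply/integrableP; split; first exact/measurable_EFinP.
  under eq_integral do rewrite /= ger0_norm ?normc_ge0//.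
  by rewrite ltey.
have iR : mu.-integrable D (EFin \o (fun x => complex.Re (f x))).
  apply: le_integrable iN => //; first exact/measurable_EFinP.
  by move=> x _ /=; rewrite lee_fin [leRHS]ger0_norm ?normc_ge0// norm_Re_le_normc.
have iI : mu.-integrable D (EFin \o (fun x => complex.Im (f x))).
  apply: le_integrable iN => //; first exact/measurable_EFinP.
  by move=> x _ /=; rewrite lee_fin [leRHS]ger0_norm ?normc_ge0// norm_Im_le_normc.
set z := Cintegral mu D f.
rewrite -[leRHS]fineK; last exact: integrable_fin_num iN.
rewrite lee_fin -/(Rintegral _ _ _).
have [->|z0] := eqVneq (Normc.normc z) 0.
  by apply: Rintegral_ge0 => x _; exact: normc_ge0.
have zp : 0 < Normc.normc z by rewrite lt_neqAle eq_sym z0 normc_ge0.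
rewrite -(ler_pM2l zp) -expr2 normc_sqr.
(* Only one factor of each square is unfolded: the other stays a constant and moves under the
   integral. *)
rewrite !expr2 {2 4}/z /= -!RintegralZl//.
have iRz := integrableZl mD (complex.Re z) iR.
have iIz := integrableZl mD (complex.Im z) iI.
rewrite -RintegralD//.
apply: le_Rintegral => //.
- exact: (integrableD mD iRz iIz).
- exact: (integrableZl mD _ iN).

by move=> x _; exact: (dot_le_normcM z (f x)).
Qed.

(** Tonelli gives measurability for the positive and negative parts separately. The real integral is
    [fine] of their difference at every [s], also where the section is not integrable. *)
Lemma measurable_fun_Rintegral d1 d2 (T1 : measurableType d1)
    (T2 : measurableType d2) (R : realType)
    (m2 : {sigma_finite_measure set T2 -> \bar R}) (h : T1 * T2 -> R) :
  measurable_fun setT h ->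
  measurable_fun setT (fun s => Rintegral m2 setT (fun y => h (s, y))).
Proof.
move=> mh; have mE : measurable_fun setT (fun z => (h z)%:E) by exact/measurable_EFinP.
pose hE z := (h z)%:E.
have mp : measurable_fun setT (fubini_F m2 (hE^\+)%E).
  by apply: measurable_fun_fubini_tonelli_F => //; exact: measurable_funepos.
have mn : measurable_fun setT (fubini_F m2 (hE^\-)%E).
  by apply: measurable_fun_fubini_tonelli_F => //; exact: measurable_funeneg.
have -> : (fun s => Rintegral m2 setT (fun y => h (s, y))) =
    fine \o (fubini_F m2 (hE^\+) \- fubini_F m2 (hE^\-))%E.
  apply/funext => s; rewrite /Rintegral integralE /=; apply: congr1.
  by congr (_ - _)%E; apply: eq_integral => y _; rewrite !unlock.
by apply: measurableT_comp => //; exact: emeasurable_funB.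
Qed.

(** The triangle inequality is applied to the outer integral, then to the inner one for each [s]. *)
Lemma le_normc_Cintegral2 d1 d2 (T1 : measurableType d1)
    (T2 : measurableType d2) (R : realType)
    (m1 : {measure set T1 -> \bar R})
    (m2 : {sigma_finite_measure set T2 -> \bar R})
    (D : set T1) (f : T1 * T2 -> R[i]) :
  measurable D ->
  measurable_fun setT (fun z => complex.Re (f z)) ->
  measurable_fun setT (fun z => complex.Im (f z)) ->
  ((Normc.normc (Cintegral m1 D (fun s => Cintegral m2 setT (fun y => f (s, y)))))%:E
   <= \int[m1]_(s in D) \int[m2]_y (Normc.normc (f (s, y)))%:E)%E.
Proof.
move=> mD mr mi.
have mR := measurable_fun_Rintegral m2 mr.
have mI := measurable_fun_Rintegral m2 mi.
have mN : measurable_fun setT (fun z => (Normc.normc (f z))%:E).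
  by apply/measurable_EFinP; exact: measurable_normc.
apply: le_trans (le_normc_Cintegral _ mD _ _) _.
- exact: measurable_funTS.
- exact: measurable_funTS.
apply: ge0_le_integral => //.
- by move=> s _; rewrite lee_fin normc_ge0.
- by apply/measurable_EFinP/measurable_funTS; exact: measurable_normc.
- apply: measurable_funTS; apply: (measurable_fun_fubini_tonelli_F _ mN) => z.
  by rewrite lee_fin normc_ge0.
move=> s _; apply: le_normc_Cintegral => //.
  exact: (measurableT_comp mr).
exact: (measurableT_comp mi).
Qed.

(* A continuous function is the pointwise limit of its values at the points of
   the grids of mesh 1/(k+1), and each approximation factors through a
   countable type. *)
Section continuous_measurable.
Context {R : realType} {n : nat}.

Let grid_floor (k : nat) (p : R * 'rV[R]_n) : int * 'rV[int]_n :=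
  (Num.floor (p.1 * k.+1%:R), map_mx (fun a => Num.floor (a * k.+1%:R)) p.2).

Let grid_point (k : nat) (q : int * 'rV[int]_n) : R * 'rV[R]_n :=
  (q.1%:~R / k.+1%:R, map_mx (fun a => a%:~R / k.+1%:R) q.2).

Lemma measurable_floor_eq (k : nat) (a : int) :
  measurable [set x : R | Num.floor (x * k.+1%:R) = a].
Proof.
rewrite (_ : [set x | _] = `[a%:~R / k.+1%:R, (a + 1)%:~R / k.+1%:R[%classic) //.
apply/seteqP; split => x /=; rewrite in_itv/= ler_pdivrMr// ltr_pdivlMr//.
  by move=> <-; exact: floor_itv.
by move=> ?; exact: floor_def.
Qed.

Lemma measurable_grid_floor_eq k q : measurable (grid_floor k @^-1` [set q]).
Proof.
case: q => a v.
rewrite (_ : _ @^-1` _ = [set x | Num.floor (x * k.+1%:R) = a] `*`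
  \bigcap_(i in [set: 'I_n])
    (rV_coord i @^-1` [set x | Num.floor (x * k.+1%:R) = v ord0 i])).
  apply: measurableX; first exact: measurable_floor_eq.
  apply: fin_bigcap_measurable; first exact: finite_finset.
  move=> i _; rewrite -[X in measurable X]setTI.
  by apply: (@measurable_rV_coord R n i measurableT); exact: measurable_floor_eq.
apply/seteqP; split => -[t x] /=.
  by case=> <- <-; split => // i _ /=; rewrite mxE.
move=> [/= <- xv]; congr pair; apply/rowP => i; rewrite mxE.
exact: xv.
Qed.

Lemma grid_cvg (p : R * 'rV[R]_n) :
  grid_point k (grid_floor k p) @[k --> \oo] --> p.
Proof.
have cvg1 (a : R) : (Num.floor (a * k.+1%:R))%:~R / k.+1%:R @[k --> \oo] --> a.
  (* The rounded value lies within one mesh width 1/(k+1) below [a]. *)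
  apply: (@squeeze_cvgr _ _ _ _ (fun k => a - k.+1%:R^-1) (fun=> a)).
  - near=> k; have /andP[h1 h2] := floor_itv (a * k.+1%:R).
    rewrite ler_pdivrMr// h1 andbT ler_pdivlMr// mulrBl mulVf//.
    by rewrite lerBlDr -(intrD _ _ 1) ltW.
  - rewrite -[X in _ --> X]subr0; apply: cvgB; first exact: cvg_cst.
    exact: cvg_harmonic.
  - exact: cvg_cst.
have -> : p = (p.1, p.2) by case: p.
have cvg2 : (grid_point k (grid_floor k p)).2 @[k --> \oo] --> p.2.
  apply/cvg_ballP => e e0.
  have : \forall k \near \oo, forall i : 'I_n,
      ball (p.2 ord0 i) e ((Num.floor (p.2 ord0 i * k.+1%:R))%:~R / k.+1%:R).
    by apply: filter_forall => i; move: e e0; apply/cvg_ballP; exact: cvg1.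
  apply: filterS => k H; split => // i j.
  by rewrite !ord1 !mxE; exact: H.
exact: cvg_pair (cvg1 p.1) cvg2.
Unshelve. all: by end_near. Qed.

(** This links the topology with the sigma-algebra generated by the coordinates, and is how the
    smoothness of [phi] yields measurability. *)
Lemma continuous_measurable_spacetime (f : R * 'rV[R]_n -> R) :
  continuous f -> measurable_fun setT f.
Proof.
move=> cf; apply: (@measurable_fun_cvg _ _ _ _
  (fun k p => f (grid_point k (grid_floor k p)))); last first.
  by move=> p _; exact: (cvg_comp _ _ (@grid_cvg p) (cf p)).
move=> k _ Y mY; rewrite setTI.
rewrite (_ : _ @^-1` _ = \bigcup_q
    (if f (grid_point k q) \in Y then grid_floor k @^-1` [set q] else set0)).
  apply: countable_bigcupT_measurable => // q.
  by case: ifP => // _; exact: measurable_grid_floor_eq.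
apply/seteqP; split => [p Yp|p [q _]].
  by exists (grid_floor k p) => //; rewrite mem_set.
by case: ifPn => // /set_mem Yq /= ->.
Qed.

End continuous_measurable.

(** * Integration of products of one-variable functions over R^n *)

(** Induction on the dimension: [lebesgue_rV] is built by pushing a product measure forward along
    [rV_cons], so Tonelli splits off the first coordinate. In dimension 0 the measure is a unit mass
    and the product is empty. *)
Lemma ge0_integral_rV_prod (R : realType) n (f : 'I_n -> R -> R) :
  (forall i, measurable_fun setT (f i)) -> (forall i x, 0 <= f i x) ->
  (\int[lebesgue_rV n]_x (\prod_(i < n) f i (x ord0 i))%:E =
   \prod_(i < n) \int[lebesgue_measure]_x (f i x)%:E)%E.
Proof.
elim: n f => [|n IH] f mf f0.
  rewrite big_ord0 /=; under eq_integral do rewrite big_ord0.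
  rewrite integral_cst ?mul1e /=; last exact: measurableT.
  by rewrite /dirac indicT.
have mF m (g : 'I_m -> R -> R) : (forall i, measurable_fun setT (g i)) ->
    measurable_fun setT (fun x : 'rV[R]_m => \prod_(i < m) g i (x ord0 i)).
  move=> mg; apply: measurable_prod => i _.
  exact: measurableT_comp (mg i) (measurable_rV_coord i).
rewrite big_ord_recl -IH// /= ge0_integral_pushforward//=; first last.
- by move=> x _; rewrite lee_fin prodr_ge0.
- by apply/measurable_EFinP; exact: mF.
- exact: measurable_rV_cons.
rewrite preimage_setT.
pose h (p : R * 'rV[R]_n) :=
  (f ord0 p.1 * \prod_(i < n) f (lift ord0 i) (p.2 ord0 i))%:E.
transitivity (\int[lebesgue_measure \x lebesgue_rV n]_p h p)%E.
  apply: eq_integral => p _; rewrite /h /= big_ord_recl rV_cons0.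
  by congr (_ * _)%:E; apply: eq_bigr => i _; rewrite rV_consS.
have mh : measurable_fun setT h.
  apply/measurable_EFinP; apply: measurable_funM.
    exact: measurableT_comp (mf ord0) measurable_fst.
  exact: measurableT_comp (mF _ _ (fun i => mf (lift ord0 i))) measurable_snd.
have h0 p : (0 <= h p)%E by rewrite lee_fin mulr_ge0 ?prodr_ge0.
transitivity (\int[lebesgue_measure]_a fubini_F (lebesgue_rV n) h a)%E.
  exact: fubini_tonelli1.
rewrite /fubini_F /h /=; under eq_integral => a _.
  under eq_integral do rewrite EFinM.
  rewrite ge0_integralZl//; last 3 first.
  - by apply/measurable_EFinP; exact: mF (fun i => mf (lift ord0 i)).
  - by move=> x _; rewrite lee_fin prodr_ge0.
  - by rewrite lee_fin.
  over.
rewrite ge0_integralZr//.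
- by apply/measurable_EFinP; exact: mf.
- by move=> x _; rewrite lee_fin.
- by apply: integral_ge0 => x _; rewrite lee_fin prodr_ge0.
Qed.

(** * Euclidean inner product and norm *)

Section dotv_theory.
Context {R : realType} {n : nat}.
Implicit Types (x y z : 'rV[R]_n) (a : R).

Lemma dotvC x y : dotv x y = dotv y x.
Proof. by apply: eq_bigr => i _; rewrite mulrC. Qed.

Lemma dotvDr x y z : dotv x (y + z) = dotv x y + dotv x z.
Proof. by rewrite -big_split; apply: eq_bigr => i _; rewrite mxE mulrDr. Qed.

Lemma dotvZr a x y : dotv x (a *: y) = a * dotv x y.
Proof. by rewrite mulr_sumr; apply: eq_bigr => i _; rewrite mxE mulrCA. Qed.

Lemma dotvNr x y : dotv x (- y) = - dotv x y.
Proof. by rewrite -scaleN1r dotvZr mulN1r. Qed.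

Lemma dotvBr x y z : dotv x (y - z) = dotv x y - dotv x z.
Proof. by rewrite dotvDr dotvNr. Qed.

Lemma dotv_ge0 x : 0 <= dotv x x.
Proof. by apply: sumr_ge0 => i _; rewrite -expr2 sqr_ge0. Qed.

Lemma enorm_sqr x : enorm x ^+ 2 = dotv x x.
Proof. by rewrite sqr_sqrtr// dotv_ge0. Qed.

Lemma enormN x : enorm (- x) = enorm x.
Proof. by rewrite /enorm dotvNr dotvC dotvNr opprK. Qed.

Lemma enorm_gt0 x : x != 0 -> 0 < enorm x.
Proof.
move=> x0; rewrite sqrtr_gt0 lt_neqAle dotv_ge0 andbT eq_sym.
apply: contra x0; rewrite psumr_eq0; last by move=> i _; rewrite -expr2 sqr_ge0.
move=> /allP h; apply/eqP/rowP => i; rewrite mxE; apply/eqP.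
by have := h i (mem_index_enum i); rewrite mulf_eq0 orbb.
Qed.

End dotv_theory.

(** * Mass of the heat kernel and its product with the weight *)

Section heat_kernel_theory.
Context {R : realType} {n : nat}.
Implicit Types (x y m : 'rV[R]_n) (t : R).

Lemma heat_kernel_ge0 t x : 0 <= heat_kernel t x.
Proof. by rewrite mulr_ge0 ?powR_ge0 ?expR_ge0. Qed.

Lemma heat_kernelN t x : heat_kernel t (- x) = heat_kernel t x.
Proof. by rewrite /heat_kernel enormN. Qed.

(** The heat kernel at time t is the Gaussian density with independent coordinates of variance 2t,
    whence the standard deviation sqrt(2t). *)
Lemma heat_kernel_prod t x m : 0 < t ->
  heat_kernel t (x - m) =
  \prod_(i < n) normal_pdf (m ord0 i) (Num.sqrt (2 * t)) (x ord0 i).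
Proof.
move=> t0.
have s2 : Num.sqrt (2 * t) ^+ 2 = 2 * t by rewrite sqr_sqrtr// mulr_ge0// ltW.
have s0 : Num.sqrt (2 * t) != 0 by rewrite gt_eqF// sqrtr_gt0 mulr_gt0.
under eq_bigr do rewrite normal_pdfE//.
rewrite big_split /= prodr_const card_ord -expR_sum; congr (_ * expR _).
  rewrite /normal_peak s2.
  have -> : 2 * t * pi *+ 2 = 4 * pi * t by rewrite -mulr_natr; ring.
  rewrite powRN -powR12_sqrt ?mulr_ge0 ?pi_ge0 ?ltW// exprVn.
  by rewrite -powR_mulrn ?powR_ge0// -powRrM [2^-1 * _]mulrC.
rewrite enorm_sqr s2 /dotv -sumrN mulr_suml; apply: eq_bigr => i _.
by rewrite !mxE -expr2; congr (_ / _); rewrite -mulr_natr; ring.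
Qed.

(** A product of probability densities. Carrying the mean [m] along covers all translates without
    translation invariance on R^n. *)
Lemma integral_heat_kernel t m : 0 < t ->
  (\int[lebesgue_rV n]_x (heat_kernel t (x - m))%:E = 1)%E.
Proof.
move=> t0; under eq_integral do rewrite heat_kernel_prod//.
rewrite (@ge0_integral_rV_prod _ _
  (fun i => normal_pdf (m ord0 i) (Num.sqrt (2 * t)))); first last.
- by move=> i x; exact: normal_pdf_ge0.
- by move=> i; exact: measurable_normal_pdf.
by rewrite big1// => i _; exact: integral_normal_pdf.
Qed.

(** The exponent is linear in (t, x). This lets the weight pass through a convolution, one factor
    going to the kernel and one to [phi]. *)
Lemma exp_weightD lambda nu (p q : R * 'rV[R]_n) :
  exp_weight lambda nu (p + q) = exp_weight lambda nu p * exp_weight lambda nu q.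
Proof. by rewrite /exp_weight -expRD; congr expR; rewrite /= dotvDr; ring. Qed.

(* Completing the square. *)
Lemma exp_weight_heat_kernel lambda (nu : 'rV[R]_n) t x : nu != 0 -> 0 < t ->
  exp_weight lambda nu (t, x) * heat_kernel t (x + (2 * t) *: nu) =
  expR (- (2 * lambda * enorm nu) * t) *
  heat_kernel t (x + (2 * t) *: nu - (2 * t * lambda / enorm nu) *: nu).
Proof.
move=> nu0 t0; rewrite /exp_weight /heat_kernel mulrCA [RHS]mulrCA -!expRD.
congr (_ * expR _); rewrite !enorm_sqr /=.
set y := x + _.
have N0 : enorm nu != 0 by rewrite gt_eqF// enorm_gt0.
have dy : dotv nu y = dotv nu x + 2 * t * enorm nu ^+ 2.
  by rewrite dotvDr dotvZr enorm_sqr.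
(* For c = 2 t lambda / |nu|, dividing by 4t turns the cross term into lambda nu.x / |nu| + 2 t
   lambda |nu| and the last term into lambda^2 t. *)
have dB c : dotv (y - c *: nu) (y - c *: nu) =
    dotv y y - 2 * c * dotv nu y + c ^+ 2 * enorm nu ^+ 2.
  rewrite dotvBr dotvZr ![dotv (y - _) _]dotvC !dotvBr !dotvZr (dotvC y).
  by rewrite enorm_sqr; ring.
rewrite dB dotvC dotvZr [dotv x nu]dotvC dy.
by field; rewrite gt_eqF// N0.
Qed.

End heat_kernel_theory.

(** * Translation and reflection invariance on the line *)

Section lebesgue_isometries.
Context {R : realType}.
Local Notation mu := (@lebesgue_measure R).

Lemma ge0_integral_lebesgue_preserving (phi : R -> R) (F : R -> \bar R) :
  measurable_fun setT phi ->
  (forall A : set R, measurable A -> mu (phi @^-1` A) = mu A) ->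
  measurable_fun setT F -> (forall x, 0 <= F x)%E ->
  (\int[mu]_x F (phi x) = \int[mu]_x F x)%E.
Proof.
move=> mphi phiE mF F0.
transitivity (\int[pushforward mu (phi : _ -> measurableTypeR R)]_x F x)%E.
  by rewrite ge0_integral_pushforward.
by apply: eq_measure_integral => //= A mA _; exact: phiE.
Qed.

(** By uniqueness it suffices to compare the two measures on half-open intervals ]a, b], whose
    preimages are ]a + s, b + s]. *)
Lemma lebesgue_measure_shift (s : R) (A : set R) : measurable A ->
  mu ((fun x => x - s) @^-1` A) = mu A.
Proof.
move=> mA; have mphi : measurable_fun setT (fun x : R => x - s : measurableTypeR R).
  exact: measurable_funB.
rewrite -[LHS]/(pushforward mu (fun x : R => x - s : measurableTypeR R) A).
apply/esym/lebesgue_measure_unique => //= _ [[a b]] _ <-.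
rewrite /pushforward.
rewrite (_ : _ @^-1` _ = `]a + s, b + s]%classic).
  rewrite !lebesgue_measure_itv/= !lte_fin ltrD2r; case: ifP => // _.
  by rewrite -!EFinB; congr EFin; ring.
by apply/seteqP; split => x /=; rewrite !in_itv/= ltrBrDr lerBlDr.
Qed.

Lemma ge0_integral_shift (s : R) (F : R -> \bar R) :
  measurable_fun setT F -> (forall x, 0 <= F x)%E ->
  (\int[mu]_x F (x - s)%R = \int[mu]_x F x)%E.
Proof.
apply: ge0_integral_lebesgue_preserving; first exact: measurable_funB.
exact: lebesgue_measure_shift.
Qed.

Lemma ge0_integral_reflect (s : R) (F : R -> \bar R) :
  measurable_fun setT F -> (forall x, 0 <= F x)%E ->
  (\int[mu]_x F (s - x)%R = \int[mu]_x F x)%E.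
Proof.
apply: ge0_integral_lebesgue_preserving; first exact: measurable_funB.
move=> A mA.
have -> : (fun x => s - x) @^-1` A =
    (fun x => x - s) @^-1` ((-%R : R -> R) @^-1` A).
  by apply/seteqP; split => x /=; rewrite opprB.
rewrite lebesgue_measure_shift; first exact: lebesgue_measureN.
by rewrite -[X in measurable X]setTI; apply: oppr_measurable.
Qed.

End lebesgue_isometries.

(** * Measurability of the heat kernel in time and space *)

(** The formula 1/x = x (x^2)^(-1) reduces the inverse to a real power of a nonnegative number; at 0
    both sides are 0 because of the convention for the inverse. *)
Lemma measurable_invr (R : realType) :
  measurable_fun setT (fun x : R => x^-1).
Proof.
have -> : (fun x : R => x^-1) = fun x => x * (x ^+ 2) `^ (-1).
  apply/funext => x; have [->|x0] := eqVneq x 0; first by rewrite invr0 mul0r.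
  by rewrite powRN powRr1 ?sqr_ge0// expr2 invfM mulVKf.
apply: measurable_funM => //.
by apply: measurableT_comp (measurable_powR _) _; exact: measurable_funX.
Qed.

Section measurable_rV_ops.
Context {R : realType} {n : nat} {d : measure_display} {T : measurableType d}.
Implicit Types (f g : T -> 'rV[R]_n) (a : T -> R).

Lemma measurable_rV_addr f g : measurable_fun setT f -> measurable_fun setT g ->
  measurable_fun setT (fun p => f p + g p).
Proof.
move=> mf mg; apply: measurable_fun_rVP => i; rewrite /rV_coord.
under eq_fun do rewrite mxE.
apply: measurable_funD.
  exact: measurableT_comp (measurable_rV_coord i) mf.
exact: measurableT_comp (measurable_rV_coord i) mg.
Qed.

Lemma measurable_rV_scaler a g : measurable_fun setT a -> measurable_fun setT g ->
  measurable_fun setT (fun p => a p *: g p).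
Proof.
move=> ma mg; apply: measurable_fun_rVP => i; rewrite /rV_coord.
under eq_fun do rewrite mxE.
apply: measurable_funM => //.
exact: measurableT_comp (measurable_rV_coord i) mg.
Qed.

Lemma measurable_rV_subr f g : measurable_fun setT f -> measurable_fun setT g ->
  measurable_fun setT (fun p => f p - g p).
Proof.
move=> mf mg; apply: measurable_rV_addr => //.
under eq_fun do rewrite -scaleN1r.
exact: measurable_rV_scaler.
Qed.

Lemma measurable_dotv f g : measurable_fun setT f -> measurable_fun setT g ->
  measurable_fun setT (fun p => dotv (f p) (g p)).
Proof.
move=> mf mg; apply: measurable_sum => i.
apply: measurable_funM.
  exact: measurableT_comp (measurable_rV_coord i) mf.
exact: measurableT_comp (measurable_rV_coord i) mg.
Qed.

Lemma measurable_heat_kernel a g : measurable_fun setT a -> measurable_fun setT g ->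
  measurable_fun setT (fun p => heat_kernel (a p) (g p)).
Proof.
move=> ma mg; apply: measurable_funM.
  apply: measurableT_comp (measurable_powR _) _.
  exact: measurable_funM.
apply: measurableT_comp => //; apply: measurable_funM.
  apply: measurable_funN; under eq_fun do rewrite enorm_sqr.
  exact: measurable_dotv.
by apply: measurableT_comp (@measurable_invr R) _; exact: measurable_funM.
Qed.

End measurable_rV_ops.

(** * The weighted kernel and its row and column integrals *)

Section drift_kernel.
Context {R : realType} {n : nat}.
Variables (lambda : R) (nu : 'rV[R]_n).
Hypotheses (lambda0 : 0 < lambda) (nu0 : nu != 0).

Let rate := 2 * lambda * enorm nu.

(** The kernel K, cut off at nonpositive times. The cut-off encodes causality: in a convolution it
    discards the times s >= t. *)
Definition drift_kernel (p : R * 'rV[R]_n) : R :=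
  if 0 < p.1 then
    exp_weight lambda nu p * heat_kernel p.1 (p.2 + (2 * p.1) *: nu)
  else 0.

Lemma rate_gt0 : 0 < rate.
Proof. by rewrite !mulr_gt0// enorm_gt0. Qed.

Lemma drift_kernel_ge0 p : 0 <= drift_kernel p.
Proof.
by rewrite /drift_kernel; case: ifP => // _; rewrite mulr_ge0 ?expR_ge0 ?heat_kernel_ge0.
Qed.

Lemma measurable_exp_weight :
  measurable_fun [set: R * 'rV[R]_n] (exp_weight lambda nu).
Proof.
apply: measurableT_comp => //; apply: measurable_funD.
  exact: measurable_funM.
by apply: measurable_funM => //; exact: measurable_dotv.
Qed.

Lemma measurable_drift_kernel : measurable_fun setT drift_kernel.
Proof.
apply: measurable_fun_ifT => //.
  exact: measurable_fun_ltr.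
apply: measurable_funM; first exact: measurable_exp_weight.
apply: measurable_heat_kernel => //.
apply: measurable_rV_addr => //; apply: measurable_rV_scaler => //.
exact: measurable_funM.
Qed.

Lemma drift_kernelE t x : 0 < t ->
  drift_kernel (t, x) = expR (- rate * t) *
    heat_kernel t (x + ((2 * t) *: nu - (2 * t * lambda / enorm nu) *: nu)).
Proof.
by move=> t0; rewrite /drift_kernel /= t0 exp_weight_heat_kernel// addrA.
Qed.

(** Writing the time decay through a probability density makes its total integral [rate^-1]
    immediate. *)
Lemma expR_exponential_pdf t : 0 < t ->
  expR (- rate * t) = rate^-1 * exponential_pdf rate t.
Proof.
move=> t0; rewrite exponential_pdfE ?ltW// mulKf// gt_eqF//.
exact: rate_gt0.
Qed.

(** For t > 0 this is an equality, by the unit mass of a translated heat kernel; for t <= 0 the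
    kernel vanishes and the bound is nonnegative. *)
Lemma le_integral_drift_kernel_subr t y :
  (\int[lebesgue_rV n]_x (drift_kernel (t, x - y)%R)%:E <=
   (rate^-1 * exponential_pdf rate t)%:E)%E.
Proof.
have [t0|t0] := ltP 0 t; last first.
  under eq_integral do rewrite /drift_kernel /= ltNge t0 /=.
  by rewrite integral0 lee_fin mulr_ge0 ?invr_ge0 ?exponential_pdf_ge0 ?ltW ?rate_gt0.
under eq_integral => x _.
  rewrite drift_kernelE// -addrA -[X in heat_kernel t (x + X)]opprK EFinM.
  over.
rewrite ge0_integralZl//; first last.
- by move=> x _; rewrite lee_fin heat_kernel_ge0.
- apply/measurable_EFinP; apply: measurable_heat_kernel => //.
  exact: measurable_rV_subr.
by rewrite integral_heat_kernel// mule1 expR_exponential_pdf.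
Qed.

(** The counterpart with the integration variable subtracted; evenness of the heat kernel brings it
    back to a translate in [x]. *)
Lemma le_integral_drift_kernel_subl t y :
  (\int[lebesgue_rV n]_x (drift_kernel (t, y - x)%R)%:E <=
   (rate^-1 * exponential_pdf rate t)%:E)%E.
Proof.
have [t0|t0] := ltP 0 t; last first.
  under eq_integral do rewrite /drift_kernel /= ltNge t0 /=.
  by rewrite integral0 lee_fin mulr_ge0 ?invr_ge0 ?exponential_pdf_ge0 ?ltW ?rate_gt0.
under eq_integral => x _.
  rewrite drift_kernelE// -heat_kernelN opprD opprB -addrA -opprD EFinM.
  over.
rewrite ge0_integralZl//; first last.
- by move=> x _; rewrite lee_fin heat_kernel_ge0.
- apply/measurable_EFinP; apply: measurable_heat_kernel => //.
  exact: measurable_rV_subr.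
by rewrite integral_heat_kernel// mule1 expR_exponential_pdf.
Qed.

Lemma measurable_convolution_kernel :
  measurable_fun setT (fun z : (R * 'rV[R]_n) * (R * 'rV[R]_n) =>
    drift_kernel (z.1.1 - z.2.1, z.1.2 - z.2.2)).
Proof.
apply: measurableT_comp measurable_drift_kernel _.
apply/measurable_fun_pairP; split => /=.
  by apply: measurable_funB; exact: measurableT_comp.
by apply: measurable_rV_subr; exact: measurableT_comp.
Qed.

(** A general [f] serves both the reflection s -> t - s of the rows and the shift s -> s - t of the
    columns. *)
Lemma integral_exponential_tail (f : R -> R) :
  (\int[lebesgue_measure]_s (exponential_pdf rate (f s))%:E = 1)%E ->
  measurable_fun setT f ->
  (\int[lebesgue_measure]_s (rate^-1 * exponential_pdf rate (f s))%:E =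
   rate^-1%:E)%E.
Proof.
move=> f1 mf; under eq_integral do rewrite EFinM.
rewrite ge0_integralZl//; first by rewrite f1 mule1.
- apply/measurable_EFinP; apply: measurableT_comp mf.
  exact: measurable_exponential_pdf.
- by move=> s _; rewrite lee_fin exponential_pdf_ge0 ?ltW ?rate_gt0.
- by rewrite lee_fin invr_ge0 ltW ?rate_gt0.
Qed.

(** Integrating in space first leaves the exponential density in p.1 - s, whose mass survives
    reflection. The result 1/(2 lambda |nu|) is the constant of the theorem. *)
Lemma drift_kernel_row p :
  (\int[lebesgue_measure \x lebesgue_rV n]_q
     (drift_kernel (p.1 - q.1, p.2 - q.2)%R)%:E <= rate^-1%:E)%E.
Proof.
have mk := measurableT_comp measurable_convolution_kernel (pair1_measurable p).
have mE : measurable_fun setT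
    (fun q : R * 'rV[R]_n => (drift_kernel (p.1 - q.1, p.2 - q.2)%R)%:E).
  exact/measurable_EFinP.
have E0 (q : R * 'rV[R]_n) : (0 <= (drift_kernel (p.1 - q.1, p.2 - q.2)%R)%:E)%E.
  by rewrite lee_fin drift_kernel_ge0.
rewrite fubini_tonelli1//.
apply: (@le_trans _ _
  (\int[lebesgue_measure]_s (rate^-1 * exponential_pdf rate (p.1 - s))%:E)%E).
  apply: ge0_le_integralT => s; first by apply: integral_ge0.
  exact: (le_integral_drift_kernel_subl (p.1 - s) p.2).
rewrite integral_exponential_tail//.
  rewrite (ge0_integral_reflect p.1 (F := fun s => (exponential_pdf rate s)%:E)).
  - by rewrite integral_exponential_pdf// rate_gt0.
  - by apply/measurable_EFinP; exact: measurable_exponential_pdf.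
  - by move=> x; rewrite lee_fin exponential_pdf_ge0 ?ltW ?rate_gt0.
exact: measurable_funB.
Qed.

Lemma drift_kernel_col q :
  (\int[lebesgue_measure \x lebesgue_rV n]_p
     (drift_kernel (p.1 - q.1, p.2 - q.2)%R)%:E <= rate^-1%:E)%E.
Proof.
have mk := measurableT_comp measurable_convolution_kernel (pair2_measurable q).
have mE : measurable_fun setT
    (fun p : R * 'rV[R]_n => (drift_kernel (p.1 - q.1, p.2 - q.2)%R)%:E).
  exact/measurable_EFinP.
have E0 (p : R * 'rV[R]_n) : (0 <= (drift_kernel (p.1 - q.1, p.2 - q.2)%R)%:E)%E.
  by rewrite lee_fin drift_kernel_ge0.
rewrite fubini_tonelli1//.
apply: (@le_trans _ _
  (\int[lebesgue_measure]_s (rate^-1 * exponential_pdf rate (s - q.1))%:E)%E).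
  apply: ge0_le_integralT => s; first by apply: integral_ge0.
  exact: (le_integral_drift_kernel_subr (s - q.1) q.2).
rewrite integral_exponential_tail//.
  rewrite (ge0_integral_shift q.1 (F := fun s => (exponential_pdf rate s)%:E)).
  - by rewrite integral_exponential_pdf// rate_gt0.
  - by apply/measurable_EFinP; exact: measurable_exponential_pdf.
  - by move=> x; rewrite lee_fin exponential_pdf_ge0 ?ltW ?rate_gt0.
exact: measurable_funB.
Qed.

End drift_kernel.

(* The space-time measure pushes forward to the sigma-finite lebesgue_rV n.+1. *)
Lemma sigma_finite_lebesgue_spacetime (R : realType) n :
  sigma_finite setT (lebesgue_spacetime R n).
Proof.
have [F TF Foo] := sigma_finiteT
  (lebesgue_rV n.+1 : {sigma_finite_measure set 'rV[R]_n.+1 -> \bar R}).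
exists (fun k => @rV_cons R n @^-1` F k).
  by rewrite -preimage_bigcup -TF preimage_setT.
move=> k; have [mF Fk] := Foo k; split; last exact: Fk.
by rewrite -[X in measurable X]setTI; exact: measurable_rV_cons.
Qed.

(* The canonical sigma-finite instance for product measures in the library only
   applies to subprobabilities, hence the explicit packing. *)
Definition spacetime_measure (R : realType) n :
    {sigma_finite_measure set (measurableTypeR R * 'rV[R]_n)%type -> \bar R} :=
  HB.pack_for {sigma_finite_measure set (measurableTypeR R * 'rV[R]_n)%type -> \bar R}
    (Measure.sort (lebesgue_spacetime R n))
    (@Measure_isSigmaFinite.Build _ _ _ (lebesgue_spacetime R n)
      (@sigma_finite_lebesgue_spacetime R n)).

Lemma normcZ (R : rcfType) (a : R) (z : R[i]) :
  0 <= a -> Normc.normc (a%:C * z) = a * Normc.normc z.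
Proof.
by move=> a0; rewrite Normc.normcM /= expr0n /= addr0 sqrtr_sqr ger0_norm.
Qed.

(** * Pointwise domination of the weighted operator by a convolution *)

Section weighted_bound.
Context {R : realType} {n : nat}.
Variables (lambda : R) (nu : 'rV[R]_n) (phi : R * 'rV[R]_n -> R[i]).
Hypotheses (mre : measurable_fun setT (fun q => complex.Re (phi q)))
  (mim : measurable_fun setT (fun q => complex.Im (phi q))).

Let w : R * 'rV[R]_n -> R := exp_weight lambda nu.
Let g q := w q * Normc.normc (phi q).
Let k (z : (R * 'rV[R]_n) * (R * 'rV[R]_n)) :=
  drift_kernel lambda nu (z.1.1 - z.2.1, z.1.2 - z.2.2).

Lemma measurable_weighted_normc : measurable_fun setT g.
Proof.
apply: measurable_funM; first exact: measurable_exp_weight.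
exact: measurable_normc.
Qed.

Lemma weighted_normc_ge0 q : 0 <= g q.
Proof. by rewrite mulr_ge0 ?expR_ge0 ?normc_ge0. Qed.

(** The modulus moves inside both integrals, the weight is distributed by its multiplicativity, and
    the range 0 < s < t is enlarged to all times because the integrand is nonnegative. *)
Lemma le_weighted_heat_drift z :
  ((Normc.normc ((w z)%:C * heat_drift nu phi z))%:E <=
   \int[lebesgue_measure \x lebesgue_rV n]_q (k (z, q) * g q)%:E)%E.
Proof.
have mg := measurable_weighted_normc.
have mk : measurable_fun setT (fun q => k (z, q)).
  exact: measurableT_comp (measurable_convolution_kernel lambda nu) (pair1_measurable z).
have mkg : measurable_fun setT (fun q => (k (z, q) * g q)%:E).
  by apply/measurable_EFinP; exact: measurable_funM.
have kg0 q : (0 <= (k (z, q) * g q)%:E)%E.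
  by rewrite lee_fin mulr_ge0 ?drift_kernel_ge0 ?weighted_normc_ge0.
rewrite normcZ ?expR_ge0// fubini_tonelli1//.
case: z mk mkg kg0 => t x mk mkg kg0.
pose h q := heat_kernel (t - q.1) (x - q.2 + (2 * (t - q.1)) *: nu).
have mh : measurable_fun setT h.
  apply: measurable_heat_kernel; first exact: measurable_funB.
  apply: measurable_rV_addr; first exact: measurable_rV_subr.
  apply: measurable_rV_scaler => //; apply: measurable_funM => //.
  exact: measurable_funB.
pose f q := (h q)%:C * phi q.
have fRe q : complex.Re (f q) = h q * complex.Re (phi q).
  by rewrite /f; case: (phi q) => a b /=; rewrite mul0r subr0.
have fIm q : complex.Im (f q) = h q * complex.Im (phi q).
  by rewrite /f; case: (phi q) => a b /=; rewrite mul0r addr0.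
have mfr : measurable_fun setT (fun q => complex.Re (f q)).
  by under eq_fun do rewrite fRe; exact: measurable_funM.
have mfi : measurable_fun setT (fun q => complex.Im (f q)).
  by under eq_fun do rewrite fIm; exact: measurable_funM.
have mf : measurable_fun setT (fun q => Normc.normc (f q)) by exact: measurable_normc.
have mF : measurable_fun setT
    (fubini_F (lebesgue_rV n) (fun q => (Normc.normc (f q))%:E)).
  apply: measurable_fun_fubini_tonelli_F; first exact/measurable_EFinP.
  by move=> q; rewrite lee_fin normc_ge0.
have mD : measurable (`]0, t[%classic : set (measurableTypeR R)) by exact: measurable_itv.
have key := le_normc_Cintegral2
  (lebesgue_measure : {measure set (measurableTypeR R) -> \bar R})
  (lebesgue_rV n) mD mfr mfi.
rewrite EFinM.
apply: (@le_trans _ _ ((w (t, x))%:E * \int[lebesgue_measure]_(s in `]0%R, t[)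
   \int[lebesgue_rV n]_y (Normc.normc (f (s, y)))%:E)%E).
  by apply: lee_wpmul2l => //; rewrite lee_fin expR_ge0.
rewrite integral_mkcond -ge0_integralZl//; first last.
- by rewrite lee_fin expR_ge0.
- move=> s _; apply: erestrict_ge0 => {}s _.
  by apply: integral_ge0 => y _; rewrite lee_fin normc_ge0.
- by apply: (iffLR (measurable_restrictT _ mD)); apply: measurable_funTS; exact: mF.
apply: ge0_le_integralT => s.
  apply: mule_ge0; first by rewrite lee_fin expR_ge0.
  by apply: erestrict_ge0 => {}s _; apply: integral_ge0 => y _; rewrite lee_fin normc_ge0.
(* Outside ]0, t[ the left integrand is zero; inside, t - s > 0 and the cut-off in [drift_kernel] is
   inactive. *)
rewrite patchE; case: ifPn => [/set_mem/=|_]; last by rewrite mule0; apply: integral_ge0.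
rewrite in_itv/= => /andP[s0 st].
rewrite -ge0_integralZl//; first last.
- by rewrite lee_fin expR_ge0.
- by move=> y _; rewrite lee_fin normc_ge0.
- by apply/measurable_EFinP; exact: measurableT_comp mf (pair1_measurable s).
apply: ge0_le_integralT => y.
  by rewrite -EFinM lee_fin mulr_ge0 ?expR_ge0 ?normc_ge0.
rewrite -EFinM lee_fin /k /g /f /drift_kernel /= subr_gt0 st.
rewrite normcZ ?heat_kernel_ge0//.
(* The first factor completes [drift_kernel], the second completes [g]. *)
have -> : w (t, x) = w (t - s, x - y) * w (s, y).
  by rewrite -exp_weightD; congr w; congr pair; rewrite /= subrK.
by rewrite mulrACA.
Qed.

End weighted_bound.

Theorem theorem5p3 (R : realType) (n : nat) (hn : (1 <= n)%N)
    (lambda : R) (hlambda : 0 < lambda)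
    (nu : 'rV[R]_n) (hnu : nu != 0)
    (phi : R * 'rV[R]_n -> R[i]) (hphi : test_function (half_space R n) phi) :
  (L2norm (lebesgue_spacetime R n) (half_space R n)
     (fun z => (exp_weight lambda nu z)%:C * heat_drift nu phi z)%R
   <= ((2 * lambda * enorm nu)^-1)%:E *
      L2norm (lebesgue_spacetime R n) (half_space R n)
        (fun z => (exp_weight lambda nu z)%:C * phi z)%R)%E.
Proof.
case: hphi => sre sim _ supp.
have mre : measurable_fun setT (fun q => complex.Re (phi q)).
  (* The empty list of directions gives the continuity of the function itself. *)
  by apply: continuous_measurable_spacetime; case: (sre [::]).
have mim : measurable_fun setT (fun q => complex.Im (phi q)).
  by apply: continuous_measurable_spacetime; case: (sim [::]).
pose g q := exp_weight lambda nu q * Normc.normc (phi q).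
rewrite /L2norm.
(* As [phi] vanishes off the half-space, restricting the right-hand function does not change it, and
   the Schur test can run on all of space-time. *)
have -> : ((fun z => (Normc.normc ((exp_weight lambda nu z)%:C * phi z))%:E)
    \_ (half_space R n) = EFin \o g)%E.
  apply/funext => z; rewrite patchE /= /g normcZ ?expR_ge0//.
  case: ifPn => // /negP zD; have [->|/eqP phiz] := pselect (phi z = 0).
    by rewrite Normc.normc0 mulr0.
  by case: zD; apply/mem_set/supp/subset_closure.
have mg : measurable_fun setT g by exact: measurable_weighted_normc.
have g0 q : 0 <= g q by exact: weighted_normc_ge0.
apply: le_trans (schur_test (mu := spacetime_measure R n)
  (measurable_convolution_kernel lambda nu)
  (fun z => drift_kernel_ge0 lambda nu _) (drift_kernel_row hlambda hnu)
  (drift_kernel_col hlambda hnu) mg g0).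
apply: le_Lnorm => // z.
(* Off the half-space the restricted left side is zero, so the domination is trivial there. *)
rewrite patchE; case: ifPn => _; last by rewrite abse0.
rewrite !gee0_abs ?lee_fin ?normc_ge0//; last first.
  apply: integral_ge0 => q _.
  by rewrite lee_fin mulr_ge0 ?drift_kernel_ge0.
exact: le_weighted_heat_drift.
Qed.
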